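(* Let $\Gamma$ be a torsion-free finitely generated nilpotent group with a specified Mal'cev basis $(a_1,\dots,a_m)$, let $[\sigma]\in H^2(\Gamma)$ be skinny with respect to the canonical homomorphism, and let $\sigma$ be a 2-cocycle representative of $[\sigma]$ such that $\sigma(x,y)=q(x_1,\dots,x_m,y_1)$ for all $x,y\in\Gamma$, for some $q\in\mathbb{Q}[x_1,\dots,x_m,y_1]$. For a positive integer $n$ coprime to the denominators of the coefficients of $q$, let $\rho_n:\Gamma\to U(\ell^2(\mathbb{Z}/n\mathbb{Z}))$ be given by $$\rho_n(x)\delta_{\bar j}=\exp\left(\frac{2\pi i}{n}q(x_1,\dots,x_m,j)\right)\delta_{\bar j+\bar x_1}\qquad(j\in\mathbb{Z}).$$ Let $1\le p<\infty$. Then for all $x,y\in\Gamma$, $$\|\rho_n(xy)-\rho_n(x)\rho_n(y)\|\le\frac{2\pi|\sigma(x,y)|}{n},\qquad \|\rho_n(xy)-\rho_n(x)\rho_n(y)\|_p\le 2\pi|\sigma(x,y)|\,n^{\frac1p-1}.$$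
   Context: $\|\cdot\|$ is the operator norm and $\|M\|_p=(\operatorname{Tr}((M^*M)^{p/2}))^{1/p}$ is the unnormalized Schatten $p$-norm. A Mal'cev basis of a torsion-free finitely generated nilpotent group $\Gamma$ is a tuple $(a_1,\dots,a_m)\in\Gamma^m$ such that every $g\in\Gamma$ can be written uniquely as $g=a_1^{x_1}\cdots a_m^{x_m}$ with $(x_1,\dots,x_m)\in\mathbb{Z}^m$, and the subgroups $\Gamma_i=\langle a_i,\dots,a_m\rangle$ form a central series for $\Gamma$ (i.e. $[\Gamma,\Gamma_i]\subseteq\Gamma_{i+1}$, with $\Gamma_{m+1}=\{e\}$). Elements $x\in\Gamma$ are identified with their exponent tuples $(x_1,\dots,x_m)$. The canonical homomorphism is $\alpha:\Gamma\to\mathbb{Z}$, $\alpha(x)=x_1$. $H^2(\Gamma)$ is group cohomology with trivial coefficients $\mathbb{Z}$; a 2-cocycle is a function $\sigma:\Gamma\times\Gamma\to\mathbb{Z}$ with $\sigma(y,z)-\sigma(xy,z)+\sigma(x,yz)-\sigma(x,y)=0$ for all $x,y,z$. A class in $H^2(\Gamma)$ is skinny with respect to $\alpha\in\operatorname{Hom}(\Gamma,\mathbb{Z})$ if its restriction to $\ker(\alpha)$ is zero in $H^2(\ker(\alpha))$. For $j\in\mathbb{Z}$, $\bar j$ is its reduction mod $n$, and $\delta_{\bar j}\in\ell^2(\mathbb{Z}/n\mathbb{Z})$ is the corresponding standard basis vector. The maps $\rho_n$ are well defined and unitary-valued. *)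

(* Defs.v *)
From HB Require Import structures.
From mathcomp Require Import all_boot all_order all_algebra.
From mathcomp Require Import all_classical all_reals all_analysis.
From mathcomp Require Import complex spectral.
(* The notations of mpoly clash with those of analysis. *)
From mathcomp Require Import -(notations) mpoly.

Set Implicit Arguments.
Unset Strict Implicit.
Unset Printing Implicit Defensive.

Import Order.TTheory GRing.Theory Num.Theory.
Local Open Scope classical_set_scope.
Local Open Scope ring_scope.
Local Open Scope sesquilinear_scope.

Definition subgroup (G : groupType) (H : set G) : Prop :=
  [/\ H 1%g, forall x y, H x -> H y -> H (x * y)%g & forall x, H x -> H x^-1%g].

Definition subgroup_gen (G : groupType) (S : set G) : set G :=
  [set x | forall H : set G, subgroup H -> S `<=` H -> H x].

Definition comm_subgroup (G : groupType) (A B : set G) : set G :=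
  subgroup_gen [set z | exists x y, [/\ A x, B y & z = [~ x, y]%g]].

Definition lower_central (G : groupType) (k : nat) : set G :=
  iter k (comm_subgroup setT) setT.

Definition nilpotent_group (G : groupType) : Prop :=
  exists k, lower_central k = [set (1%g : G)].

Definition finitely_generated (G : groupType) : Prop :=
  exists s : seq G, subgroup_gen [set` s] = setT.

Definition torsion_free (G : groupType) : Prop :=
  forall (x : G) (k : nat), (0 < k)%N -> (x ^+ k)%g = 1%g -> x = 1%g.

Definition expgz (G : groupType) (x : G) (k : int) : G :=
  match k with Posz i => (x ^+ i)%g | Negz i => (x ^- i.+1)%g end.

Definition malcev_word (G : groupType) (m : nat) (a : 'I_m -> G)
    (x : {ffun 'I_m -> int}) : G :=
  (\prod_(i < m) expgz (a i) (x i))%g.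

Definition malcev_tail (G : groupType) (m : nat) (a : 'I_m -> G) (i : nat) :
    set G :=
  subgroup_gen [set a j | j in [set j : 'I_m | (i <= j)%N]].

Definition malcev_basis (G : groupType) (m : nat) (a : 'I_m -> G) : Prop :=
  (forall g : G, exists! x : {ffun 'I_m -> int}, g = malcev_word a x) /\
  (forall i : 'I_m,
     comm_subgroup setT (malcev_tail a i) `<=` malcev_tail a i.+1).

(* The exponent tuple of g; the default value is never used when a is a
   Mal'cev basis. *)
Definition malcev_coord (G : groupType) (m : nat) (a : 'I_m -> G) (g : G) :
    {ffun 'I_m -> int} :=
  xget [ffun=> 0] [set x | g = malcev_word a x].

Definition canonical_hom (G : groupType) (m : nat) (a : 'I_m.+1 -> G) (g : G) :
    int :=
  malcev_coord a g ord0.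

Definition cocycle2 (G : groupType) (s : G -> G -> int) : Prop :=
  forall x y z, s y z - s (x * y)%g z + s x (y * z)%g - s x y = 0.

(* The restriction of s to the subgroup H is the coboundary of a function
   on H; only the values of f on H matter. *)
Definition coboundary2_on (G : groupType) (H : set G) (s : G -> G -> int) :
    Prop :=
  exists f : G -> int,
    forall x y, H x -> H y -> s x y = f y - f (x * y)%g + f x.

(* Skinniness of the class of the cocycle s; it does not depend on the
   representative, since coboundaries restrict to coboundaries. *)
Definition skinny (G : groupType) (alpha : G -> int) (s : G -> G -> int) :
    Prop :=
  coboundary2_on [set x | alpha x = 0] s.

(* q has m.+2 variables: the first m.+1 are evaluated at the exponent tuple x,
   the last one (index ord_max) is y_1. *)
Definition qeval (m : nat) (q : mpoly m.+2 rat)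
    (x : {ffun 'I_m.+1 -> int}) (j : int) : rat :=
  meval
    (fun i => if unlift ord_max i is Some k then (x k)%:~R else j%:~R) q.

Definition coprime_denoms (k : nat) (q : mpoly k rat) (n : nat) : Prop :=
  forall mon, coprime n `|denq (mcoeff mon q)|%N.

Definition cis (R : realType) (t : R) : R[i] := Complex (cos t) (sin t).

(* Operators on l^2(Z/nZ) are matrices acting on column vectors, the index
   i : 'I_n standing for the class of i. *)
Definition std_basis (R : realType) (n : nat) (j : int) : 'cV[R[i]]_n :=
  \col_i ((i%:Z == j %[mod n])%Z)%:R.

Definition rho_op (R : realType) (G : groupType) (m : nat) (a : 'I_m.+1 -> G)
    (q : mpoly m.+2 rat) (n : nat) (x : G) : 'M[R[i]]_n :=
  \matrix_(i, j)
    (cis (2 * pi / n%:R * ratr (qeval q (malcev_coord a x) j%:Z))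
     * std_basis R n (j%:Z + canonical_hom a x) i 0).

Definition l2norm (R : realType) (n : nat) (v : 'cV[R[i]]_n) : R :=
  Num.sqrt (\sum_i (complex.Re (v i 0) ^+ 2 + complex.Im (v i 0) ^+ 2)).

Definition opnorm (R : realType) (n : nat) (M : 'M[R[i]]_n) : R :=
  sup [set l2norm (M *m v) | v in [set v : 'cV[R[i]]_n | l2norm v <= 1]].

(* The power A^s of a positive semidefinite matrix A, by functional calculus
   in a unitary diagonalisation of A. *)
Definition psd_powmx (R : realType) (n : nat) (A : 'M[R[i]]_n) (s : R) :
    'M[R[i]]_n :=
  invmx (spectralmx A)
  *m diag_mx (map_mx (fun z : R[i] => (complex.Re z `^ s)%:C%C)
                     (spectral_diag A))
  *m spectralmx A.

Definition schatten (R : realType) (n : nat) (p : R) (M : 'M[R[i]]_n) : R :=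
  (complex.Re (\tr (psd_powmx (M ^t* *m M) (p / 2)))) `^ p^-1.

Lemma malcev_coordK (G : groupType) (m : nat) (a : 'I_m -> G) :
  malcev_basis a -> cancel (malcev_word a) (malcev_coord a).
Proof.
move=> [a_uniq _] x; have [z [_ z_uniq]] := a_uniq (malcev_word a x).
have e : [set t | malcev_word a x = malcev_word a t]
    (malcev_coord a (malcev_word a x)) by apply: xgetPex; exists x.
by rewrite -(z_uniq _ e); apply: z_uniq.
Qed.

Lemma cisD2pi (R : realType) (t : R) (k : int) :
  cis (t + 2 * pi * k%:~R) = cis t.
Proof.
have natP (u : R) (i : nat) : cis (u + 2 * pi * i%:R) = cis u.
  have -> : 2 * pi * i%:R = (pi *+ 2) *+ i :> R by rewrite mulr_natl mulr_natr.
  by rewrite /cis (periodicn (@cosD2pi R)) (periodicn (@sinD2pi R)).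
case: k => i; first exact: natP.
rewrite -[RHS](natP _ i.+1) -[in RHS](natP _ i.+1) natP.
by rewrite -(natP _ i.+1) NegzE mulrNz mulrN -addrA addNr addr0.
Qed.

(* The formula defining rho_op does not depend on the representative of the
   class of j, so that it holds for every integer j. *)
Lemma rho_op_std_basis (R : realType) (G : groupType) (m : nat)
    (a : 'I_m.+1 -> G) (sigma : G -> G -> int) (q : mpoly m.+2 rat)
    (n : nat) :
  malcev_basis a ->
  (forall x y : G,
     (sigma x y)%:~R = qeval q (malcev_coord a x) (canonical_hom a y)) ->
  (0 < n)%N -> coprime_denoms q n ->
  forall (x : G) (j : int),
    rho_op R a q n x *m std_basis R n j =
    cis (2 * pi / n%:R * ratr (qeval q (malcev_coord a x) j))
    *: std_basis R n (j + canonical_hom a x).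
Proof.
move=> a_basis sigma_q n_gt0 n_cop x j.
have qint k : exists s : int, qeval q (malcev_coord a x) k = s%:~R.
  pose c : {ffun 'I_m.+1 -> int} := [ffun i => if i == ord0 then k else 0].
  exists (sigma x (malcev_word a c)).
  by rewrite sigma_q /canonical_hom malcev_coordK // ffunE eqxx.
have qmod k l : (k = l %[mod n])%Z -> exists d : int,
    qeval q (malcev_coord a x) k = qeval q (malcev_coord a x) l + (d * n)%:~R.
  move=> kl.
  pose D := \prod_(u <- msupp q) denq (mcoeff u q).
  have Ddvd u : u \in msupp q -> (denq (mcoeff u q) %| D)%Z.
    by move=> uq; rewrite /D (big_rem u) //= dvdz_mulr.
  have Dn : coprimez n D.
    rewrite /coprimez; apply: (big_ind (fun z => coprimez n z)).
    - by rewrite coprimezE coprimen1.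
    - by move=> u v; rewrite coprimezMr => -> ->.
    - by move=> u _; rewrite coprimezE; apply: n_cop.
  clearbody D.
  pose w (h : int) (i : 'I_m.+2) : int :=
    if unlift ord_max i is Some e then malcev_coord a x e else h.
  have qD h : (D%:~R * qeval q (malcev_coord a x) h : rat) =
      (\sum_(u <- msupp q)
         ((D %/ denq (mcoeff u q))%Z * numq (mcoeff u q))
         * \prod_i w h i ^+ u i)%:~R.
    rewrite /qeval mevalE mulr_sumr rmorph_sum /=.
    apply: eq_big_seq => u uq.
    rewrite mulrA rmorphM /= rmorph_prod /=; congr (_ * _).
      rewrite -[D in LHS](divzK (Ddvd u uq)) !rmorphM /= -mulrA; congr (_ * _).
      by rewrite mulrC numqE.
    by apply: eq_bigr => i _; rewrite rmorphXn /= /w; case: unlift.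
  have [[s sE] [t tE]] := (qint k, qint l).
  have : (n %| D * (s - t))%Z.
    suff -> : D * (s - t) =
        \sum_(u <- msupp q)
         ((D %/ denq (mcoeff u q))%Z * numq (mcoeff u q))
         * (\prod_i w k i ^+ u i - \prod_i w l i ^+ u i).
      apply: (big_ind (fun z => (n %| z)%Z)) => [|u v nu nv|u _].
      - exact: dvdz0.
      - exact: rpredD.
      apply: dvdz_mull; rewrite -eqz_mod_dvd; apply/eqP.
      apply: (big_ind2 (fun u v => (u = v %[mod n])%Z)) => //
        [u1 u2 v1 v2 e1 e2|i _].
        by rewrite -modzMm e1 e2 modzMm.
      by rewrite -modzXm -[RHS]modzXm /w; case: unlift => // ; rewrite kl.
    apply: (@intr_inj rat); rewrite rmorphM rmorphB /= -sE -tE mulrBr !qD.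
    rewrite -rmorphB /= -sumrB; congr (_%:~R).
    by apply: eq_bigr => u _; rewrite mulrBr.
  rewrite Gauss_dvdzr // => /dvdzP[d dE]; exists d.
  by rewrite -dE sE tE rmorphB /= addrC subrK.
have n_neq0 : n%:Z != 0 by rewrite -lt0n.
have j0P : (`|(j %% n)%Z| < n)%N.
  by rewrite -ltz_nat gez0_abs ?modz_ge0 // ltz_pmod.
pose j0 := Ordinal j0P.
have j0E : (j0%:Z = j %[mod n])%Z by rewrite /= gez0_abs ?modz_ge0 // modz_mod.
apply/matrixP => i z; rewrite ord1 !mxE (bigD1 j0) //= big1 ?addr0; last first.
  move=> k kj0; suff -> : std_basis R n j k 0 = 0 by rewrite mulr0.
  rewrite mxE -j0E !modz_small ?ltz_nat ?ltn_ord // eqz_nat.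
  by rewrite -val_eqE in kj0; rewrite (negPf kj0).
rewrite !mxE j0E eqxx mulr1; congr (_ * _); last first.
  by rewrite -(modzDml j0%:Z) j0E modzDml.
have [d ->] := qmod _ _ j0E.
rewrite rmorphD /= ratr_int mulrDr -[RHS](cisD2pi _ d); congr cis.
rewrite rmorphM /= -pmulrn; congr (_ + _).
by rewrite [d%:~R * _]mulrC mulrA divfK // pnatr_eq0 -lt0n.
Qed.

(* Main.v *)
Require Import Defs.
From HB Require Import structures.
From mathcomp Require Import all_boot all_order all_algebra.
From mathcomp Require Import all_classical all_reals all_analysis.
From mathcomp Require Import complex spectral ring zify.
From mathcomp Require Import -(notations) mpoly.

(* The canonical homomorphism alpha is additive: by downward induction, each
   tail group Gamma_i of the Mal'cev basis is normal, equals <a_i> Gamma_(i+1),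
   and consists of the words in a_i, ..., a_m, so alpha kills Gamma_2.
   The cocycle identity for (x, y, z) with alpha z = j then reads
   q(y, j) + q(x, j + y_1) = sigma(x, y) + q(xy, j), that is,
   rho(x) rho(y) = exp(i t) rho(xy) with t = 2 pi sigma(x, y) / n.  Hence the
   defect is (1 - exp(i t)) rho(xy), a unitary scaled by a number of modulus
   2 |sin (t / 2)| <= |t|, and both norms can be computed. *)

Import Order.TTheory GRing.Theory Num.Theory.
Import numFieldNormedType.Exports.
Local Open Scope classical_set_scope.
Local Open Scope ring_scope.
Local Open Scope sesquilinear_scope.

(** * Trigonometric bounds and complex phases *)

(** The mean value theorem gives [sin v = cos c * v] with |cos c| at most 1; oddness covers negative
    arguments. *)
Lemma norm_sin_le {R : realType} (u : R) : `|sin u| <= `|u|.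
Proof.
have pos (v : R) : 0 <= v -> `|sin v| <= `|v|.
  move=> v0.
  have [|c _] := MVT_segment v0 (fun x _ => @is_derive_sin R x).
    exact/continuous_subspaceT/continuous_sin.
  rewrite sin0 !subr0 => ->; rewrite normrM ler_piMl // ler_norml.
  by rewrite cos_geN1 cos_le1.
have [|/ltW u0] := leP 0 u; first exact: pos.
by rewrite -normrN -(normrN u) -sinN pos // oppr_ge0.
Qed.

Lemma cisD {R : realType} (s t : R) : cis (s + t) = cis s * cis t.
Proof.
rewrite /cis cosD sinD; apply/eqP.
by rewrite eq_complex /= eqxx addrC [cos s * sin t + _]addrC eqxx.
Qed.

Lemma conj_cisM {R : realType} (t : R) : (cis t)^* * cis t = 1.
Proof.
have -> : (cis t)^* = cis (- t) by rewrite /cis cosN sinN.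
by rewrite -cisD addNr /cis cos0 sin0.
Qed.

(** Squared form of |1 - e^(it)| = 2 |sin(t/2)|: [cis t] is the square of [cis (t / 2)], and the
    Pythagorean identity closes the computation. *)
Lemma conj_1BcisM {R : realType} (t : R) :
  (1 - cis t)^* * (1 - cis t) = ((`|2 * sin (t / 2)| ^+ 2)%:C)%C.
Proof.
have -> : cis t = cis (t / 2) * cis (t / 2) by rewrite -cisD -splitr.
rewrite real_normK ?num_real // /cis.
have /eqP := cos2Dsin2 (t / 2); move: (cos _) (sin _) => c s.
rewrite eq_sym addrC -subr_eq => /eqP c2; apply/eqP; rewrite eq_complex /=.
by apply/andP; split; apply/eqP; ring: (esym c2).
Qed.

(** * Norms of scalar multiples of unitary matrices *)

Lemma l2normE {R : realType} {n : nat} (v : 'cV[R[i]]_n) :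
  l2norm v = Num.sqrt (complex.Re ((v^t* *m v) 0 0)).
Proof.
rewrite /l2norm mxE raddf_sum; congr Num.sqrt; apply: eq_bigr => i _.
by rewrite !mxE; case: (v i 0) => x y /=; rewrite mulNr opprK !expr2.
Qed.

(** The squared norm of [M *m v] is the Hermitian form of [M^t* *m M] at [v], which here is a real
    multiple of that of [v]. *)
Lemma l2norm_similitude {R : realType} {n : nat} {r : R} {M : 'M[R[i]]_n}
  (v : 'cV[R[i]]_n) :
  0 <= r -> M^t* *m M = ((r ^+ 2)%:C)%C%:M -> l2norm (M *m v) = r * l2norm v.
Proof.
move=> r0 ME; rewrite !l2normE trmx_mul map_mxM -mulmxA (mulmxA _ M) ME.
rewrite mul_scalar_mx -scalemxAr mxE.
set z := ((v^t*) *m v) 0 0; clearbody z; case: z => x y /=.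
by rewrite mul0r subr0 sqrtrM ?sqr_ge0 // sqrtr_sqr ger0_norm.
Qed.

Lemma opnorm_similitude {R : realType} {n : nat} {r : R} {M : 'M[R[i]]_n} :
  0 <= r -> M^t* *m M = ((r ^+ 2)%:C)%C%:M -> opnorm M <= r.
Proof.
move=> r0 ME; apply: ge_sup => [|_ [v /= v1 <-]].
  (* The zero vector shows that the set under the supremum is nonempty. *)
  exists (l2norm (M *m 0)), 0 => //=.
  by rewrite l2normE mulmx0 mxE /= sqrtr0.
by rewrite (l2norm_similitude _ r0 ME) ler_piMr.
Qed.

(** The diagonalising unitary is not known explicitly, but a scalar matrix commutes with it, so the
    conjugation cancels both in the spectrum and in the power. *)
Lemma psd_powmx_scalar {R : realType} {n : nat} (c s : R) :
  psd_powmx (c%:C)%C%:M s = ((c `^ s)%:C)%C%:M :> 'M[R[i]]_n.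
Proof.
rewrite /psd_powmx; set A : 'M[R[i]]_n := _%:M.
have Pu : spectralmx A \in unitmx by exact: spectral_unit.
have An : A \is normalmx.
  apply/eqP; rewrite tr_scalar_mx map_scalar_mx; exact: scalar_mxC.
have diagE : diag_mx (spectral_diag A) = A.
  have AE := orthomx_spectralP An.
  have : spectralmx A *m A *m invmx (spectralmx A) = diag_mx (spectral_diag A).
    by rewrite {2}AE !mulmxA mulmxV // mul1mx mulmxK.
  by rewrite scalar_mxC mulmxK.
have -> : map_mx (fun z : R[i] => ((complex.Re z `^ s)%:C)%C) (spectral_diag A)
    = const_mx ((c `^ s)%:C)%C.
  apply/rowP => j; rewrite !mxE.
  by move/matrixP/(_ j j): diagE; rewrite !mxE eqxx !mulr1n => ->.
by rewrite diag_const_mx scalar_mxC mulmxKV.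
Qed.

(** The power p/2 of [M^t* *m M] is the scalar matrix r^p, of trace n r^p; then take the p-th
    root. *)
Lemma schatten_similitude {R : realType} {n : nat} {p r : R} {M : 'M[R[i]]_n} :
  0 < p -> 0 <= r -> M^t* *m M = ((r ^+ 2)%:C)%C%:M ->
  schatten p M = r * n%:R `^ p^-1.
Proof.
move=> p0 r0 ME; have rE : (r ^+ 2) `^ (p / 2) = r `^ p.
  by rewrite -powR_mulrn // -powRrM mulrC divfK.
rewrite /schatten ME psd_powmx_scalar rE mxtrace_scalar raddfMn /=.
rewrite -[_ *+ n]mulr_natl.
by rewrite powRM ?powR_ge0 // mulrC -powRrM divff ?lt0r_neq0 // powRr1.
Qed.

(** * Integer powers and generated subgroups *)

(** Differences of naturals replace the sign cases of [int] in the proof of [expgzD]. *)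
Lemma expgzB (G : groupType) (x : G) (k l : nat) :
  expgz x (k%:Z - l%:Z) = (x ^+ k / x ^+ l)%g.
Proof.
case: (leqP l k) => [lk|kl].
  by rewrite subzn //= expgnFr.
have [d ->] : exists d, l = (d.+1 + k)%N.
  by exists (l - k.+1)%N; rewrite addSnnS subnK.
have -> : k%:Z - (d.+1 + k)%N%:Z = Negz d.
  by rewrite NegzE PoszD addrC opprD addrNK.
by rewrite /= expgnDr invgM mulVKg.
Qed.

Lemma expgzD (G : groupType) (x : G) (k l : int) :
  expgz x (k + l) = (expgz x k * expgz x l)%g.
Proof.
have split_int (u : int) : exists u1 u2 : nat, u = u1%:Z - u2%:Z.
  case: u => u; first by exists u, 0%N; rewrite subr0.
  by exists 0%N, u.+1; rewrite NegzE sub0r.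
have [k1 [k2 ->]] := split_int k; have [l1 [l2 ->]] := split_int l.
have -> : k1%:Z - k2%:Z + (l1%:Z - l2%:Z) = (k1 + l1)%N%:Z - (l2 + k2)%N%:Z.
  by rewrite !PoszD opprD addrACA; congr (_ + _); rewrite addrC.
have c : commute (x ^- k2)%g (x ^+ l1)%g.
  by apply/commute_sym/commuteV/commuteX2/commute_refl.
by rewrite !expgzB !expgnDr invgM !mulgA; congr (_ * _)%g; rewrite -!mulgA c.
Qed.

Lemma subgroup_expgz {G : groupType} {H : set G} {x : G} (k : int) :
  subgroup H -> H x -> H (expgz x k).
Proof.
move=> [H1 HM HV] Hx.
have HX j : H (x ^+ j)%g by elim: j => // j ih; rewrite expgS; apply: HM.
by case: k => j /=; [|apply: HV]; apply: HX.
Qed.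

Lemma subgroup_gen_subgroup {G : groupType} (S : set G) :
  subgroup (subgroup_gen S).
Proof.
split=> [H [] //|x y Sx Sy H Hg SH|x Sx H Hg SH].
  by have [_ HM _] := Hg; apply: HM; [apply: Sx|apply: Sy].
by have [_ _ HV] := Hg; apply: HV; apply: Sx.
Qed.

Lemma sub_subgroup_gen {G : groupType} (S : set G) : S `<=` subgroup_gen S.
Proof. by move=> x Sx H _; apply. Qed.

Lemma subgroup_genS {G : groupType} (S T : set G) :
  S `<=` T -> subgroup_gen S `<=` subgroup_gen T.
Proof. by move=> ST x Sx H Hg TH; apply: Sx => // y /ST/TH. Qed.

Lemma subgroup1 {G : groupType} : subgroup [set (1%g : G)].
Proof.
by split=> //= [x y -> ->|x ->]; rewrite /= ?mulg1 ?invg1.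
Qed.

(** * Tails of a Mal'cev basis and additivity of the canonical homomorphism *)

Lemma malcev_tail_subgroup {G : groupType} {m : nat} (a : 'I_m -> G) (i : nat) :
  subgroup (malcev_tail a i).
Proof. exact: subgroup_gen_subgroup. Qed.

Lemma malcev_tail_mem {G : groupType} {m : nat} (a : 'I_m -> G) (i : nat)
  (j : 'I_m) : (i <= j)%N -> malcev_tail a i (a j).
Proof. by move=> ij; apply: sub_subgroup_gen; exists j. Qed.

Lemma malcev_tail_le {G : groupType} {m : nat} (a : 'I_m -> G) (i j : nat) :
  (i <= j)%N -> malcev_tail a j `<=` malcev_tail a i.
Proof.
move=> ij; apply: subgroup_genS => _ [k /= jk <-].
by exists k => //=; apply: leq_trans jk.
Qed.

Lemma malcev_tail_ge {G : groupType} {m : nat} (a : 'I_m -> G) (i : nat) :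
  (m <= i)%N -> malcev_tail a i `<=` [set 1%g].
Proof.
move=> mi x; apply=> [|_ [j /= ij <-]]; first exact: subgroup1.
by have := leq_trans (ltn_ord j) (leq_trans mi ij); rewrite ltnn.
Qed.

(** Normality follows from centrality: [h ^ g] differs from [h] by a commutator lying in the next,
    smaller tail. *)
Lemma malcev_tailJ {G : groupType} {m : nat} {a : 'I_m -> G} {i : nat}
  {h : G} (g : G) :
  malcev_basis a -> malcev_tail a i h -> malcev_tail a i (h ^ g)%g.
Proof.
move=> [_ a_central] hi; have [T1 TM TV] := malcev_tail_subgroup a i.
case: (leqP m i) => [mi|im].
  by rewrite (malcev_tail_ge a i mi h hi) conj1g.
have -> : (h ^ g)%g = (h * [~ g, h]^-1)%g.
  by rewrite invgR commgEl mulVKg.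
apply: TM => //; apply: TV; apply: (malcev_tail_le a i i.+1) => //.
by apply: (a_central (Ordinal im)); apply: sub_subgroup_gen; exists g, h.
Qed.

(** The products on the right form a subgroup containing the generators of the tail; closure uses
    normality of the next tail to move [h] past powers of [a i]. *)
Lemma malcev_tail_decomp {G : groupType} {m : nat} {a : 'I_m -> G} (i : 'I_m)
  {g : G} :
  malcev_basis a -> malcev_tail a i g ->
  exists (k : int) (h : G), malcev_tail a i.+1 h /\ g = (expgz (a i) k * h)%g.
Proof.
move=> a_basis; have [T1 TM TV] := malcev_tail_subgroup a i.+1.
move=> /(_ [set x | exists (k : int) (h : G),
  malcev_tail a i.+1 h /\ x = (expgz (a i) k * h)%g]).
apply=> [|_ [j /= ij <-]]; last first.
  move: ij; rewrite leq_eqVlt => /orP[/eqP/val_inj <-|ij].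
    by exists 1, 1%g; rewrite mulg1.
  by exists 0, (a j); rewrite mul1g; split=> //; apply: malcev_tail_mem.
split=> [|_ _ [k [h [hT ->]]] [l [h' [hT' ->]]]|_ [k [h [hT ->]]]].
- by exists 0, 1%g; rewrite mulg1.
- exists (k + l), (h ^ expgz (a i) l * h')%g; split.
    by apply: TM => //; apply: malcev_tailJ.
  by rewrite expgzD -!mulgA mulVKg.
- exists (- k), (h^-1 ^ expgz (a i) (- k))%g; split.
    by apply: malcev_tailJ => //; apply: TV.
  rewrite invgM -conjgC; congr (_ * _)%g.
  by apply: (mulgI (expgz (a i) k)); rewrite mulgV -expgzD subrr.
Qed.

(** In a noncommutative product the factor at [i] comes to the front because all earlier factors are
    trivial. *)
Lemma prod_ord_first {G : groupType} {m : nat} (F F' : 'I_m -> G) (i : 'I_m) :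
  (forall j : 'I_m, (j < i)%N -> F j = 1%g) ->
  (forall j : 'I_m, (j <= i)%N -> F' j = 1%g) ->
  (forall j : 'I_m, (i < j)%N -> F j = F' j) ->
  (\prod_(j < m) F j = F i * \prod_(j < m) F' j)%g.
Proof.
elim: m F F' i => [|m ih] F F' i F1 F'1 FF'; first by case: i {F1 F'1 FF'}.
rewrite !big_ord_recl (F'1 ord0) // mul1g.
case: (unliftP ord0 i) F1 F'1 FF' => [k|] -> F1 F'1 FF'.
  rewrite F1 // mul1g (ih _ (fun j => F' (lift ord0 j)) k) // => j jk.
  - exact: F1.
  - exact: F'1.
  - exact: FF'.
by congr (_ * _)%g; apply: eq_bigr => j _; apply: FF'.
Qed.

Lemma malcev_word_update {G : groupType} {m : nat} (a : 'I_m -> G) (i : 'I_m)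
  (k : int) (x : {ffun 'I_m -> int}) :
  (forall j : 'I_m, (j <= i)%N -> x j = 0) ->
  malcev_word a [ffun j => if j == i then k else x j] =
  (expgz (a i) k * malcev_word a x)%g.
Proof.
move=> x0; rewrite /malcev_word.
rewrite (prod_ord_first _ (fun j => expgz (a j) (x j)) i).
- by rewrite ffunE eqxx.
- move=> j ji; rewrite ffunE -val_eqE /= (ltn_eqF ji) x0 //; exact: ltnW.
- by move=> j ji; rewrite x0.
- by move=> j ij; rewrite ffunE -val_eqE /= (gtn_eqF ij).
Qed.

(** Induction on [m - i]: split off a power of [a i], then write the remaining factor as a word in
    the later generators. *)
Lemma malcev_tail_word {G : groupType} {m : nat} {a : 'I_m -> G} {i : nat}
  {g : G} :
  malcev_basis a -> malcev_tail a i g ->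
  exists x : {ffun 'I_m -> int},
    (forall j : 'I_m, (j < i)%N -> x j = 0) /\ g = malcev_word a x.
Proof.
move=> a_basis; have [d] := ubnP (m - i).
elim: d i g => // d ih i g mid gi; have [mi|im] := leqP m i.
  exists [ffun=> 0]; split=> [j _|]; first by rewrite ffunE.
  rewrite (malcev_tail_ge a i mi g gi) /malcev_word big1 // => j _.
  by rewrite ffunE.
have [k [h [hi ->]]] := malcev_tail_decomp (Ordinal im) a_basis gi.
have [|x [x0 ->]] := ih _ _ _ hi.
  by rewrite subnS prednK ?subn_gt0.
exists [ffun j => if j == Ordinal im then k else x j].
split; last by rewrite malcev_word_update.
move=> j ji; rewrite ffunE -val_eqE /= (ltn_eqF ji) x0 //; exact: ltnW.
Qed.

Lemma malcev_tail0 {G : groupType} {m : nat} {a : 'I_m -> G} :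
  malcev_basis a -> malcev_tail a 0 = setT.
Proof.
move=> [a_uniq _]; apply/seteqP; split=> // g _.
have [x [-> _]] := a_uniq g; have Tg := malcev_tail_subgroup a 0.
have [T1 TM _] := Tg; apply: (big_ind (malcev_tail a 0)) => // i _.
by apply: (subgroup_expgz (x i) Tg); apply: malcev_tail_mem.
Qed.

(** Indices start at 0, so [malcev_tail a 1] is the second group of the series. Its elements are
    words with first exponent 0, and prefixing a power of [a ord0] sets that exponent. *)
Lemma canonical_homE {G : groupType} {m : nat} {a : 'I_m.+1 -> G} (k : int)
  {h : G} :
  malcev_basis a -> malcev_tail a 1 h ->
  canonical_hom a (expgz (a ord0) k * h)%g = k.
Proof.
move=> a_basis /(malcev_tail_word a_basis)[x [x0 ->]].
by rewrite -malcev_word_update // /canonical_hom malcev_coordK // ffunE eqxx.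
Qed.

Lemma canonical_homM {G : groupType} {m : nat} {a : 'I_m.+1 -> G} (x y : G) :
  malcev_basis a ->
  canonical_hom a (x * y)%g = canonical_hom a x + canonical_hom a y.
Proof.
move=> a_basis; have [_ TM _] := malcev_tail_subgroup a 1.
have dec z : exists (k : int) (h : G),
    malcev_tail a 1 h /\ z = (expgz (a ord0) k * h)%g.
  by apply: (malcev_tail_decomp ord0) => //; rewrite malcev_tail0.
have [k [h [hT ->]]] := dec x; have [l [h' [hT' ->]]] := dec y.
(* Conjugating [h] collects both powers of [a ord0] on the left, with a remainder still in the
   normal tail. *)
have -> : (expgz (a ord0) k * h * (expgz (a ord0) l * h') =
    expgz (a ord0) (k + l) * (h ^ expgz (a ord0) l * h'))%g.
  by rewrite expgzD -!mulgA mulVKg.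
rewrite !canonical_homE //; apply: TM => //; exact: malcev_tailJ.
Qed.

(** * Standard basis vectors and unitarity of the operators *)

Lemma std_basis_ord {R : realType} {n : nat} (j : 'I_n) :
  std_basis R n j%:Z = delta_mx j 0.
Proof.
apply/colP => i; rewrite !mxE andbT -val_eqE /=.
by rewrite !modz_small ?eqz_nat // ltz_nat ltn_ord.
Qed.

Lemma std_basis_mod {R : realType} {n : nat} (k : int) :
  (0 < n)%N ->
  exists j : 'I_n, std_basis R n k = delta_mx j 0 /\ (k = j%:Z %[mod n])%Z.
Proof.
move=> n0; have n_neq0 : n%:Z != 0 by rewrite -lt0n.
have jP : (`|(k %% n)%Z| < n)%N.
  by rewrite -ltz_nat gez0_abs ?modz_ge0 // ltz_pmod.
have jE : (k = (Ordinal jP : nat)%:Z %[mod n])%Z.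
  by rewrite /= gez0_abs ?modz_ge0 // modz_mod.
move: (Ordinal jP) jE => j jE; exists j; split=> //.
by rewrite -std_basis_ord; apply/colP => i; rewrite !mxE jE.
Qed.

Lemma eq_mx_std_basis {R : realType} {n : nat} (A B : 'M[R[i]]_n) :
  (forall j : 'I_n, A *m std_basis R n j%:Z = B *m std_basis R n j%:Z) -> A = B.
Proof.
move=> AB; apply/matrixP => i j; have := AB j.
by rewrite std_basis_ord -!colE => /colP/(_ i); rewrite !mxE.
Qed.

(** Translation by alpha(x) permutes the residues mod n, so the columns are distinct basis vectors
    times phases of modulus 1. *)
Lemma rho_op_unitary {R : realType} {G : groupType} {m : nat}
  (a : 'I_m.+1 -> G) (q : mpoly m.+2 rat) {n : nat} (x : G) :
  (0 < n)%N -> (rho_op R a q n x)^t* *m rho_op R a q n x = 1%:M.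
Proof.
move=> n0; set U := rho_op R a q n x; apply/matrixP => i j.
have UE s t : U s t = cis (2 * pi / n%:R *
    ratr (qeval q (malcev_coord a x) t%:Z))
    * std_basis R n (t%:Z + canonical_hom a x) s 0 by rewrite mxE.
have adjE s t : (U^t*) s t = (U t s)^* by rewrite !mxE.
have [l [lE lmod]] := @std_basis_mod R n (i%:Z + canonical_hom a x) n0.
have [k [kE kmod]] := @std_basis_mod R n (j%:Z + canonical_hom a x) n0.
have ij : (l == k) = (i == j).
  apply/eqP/eqP => [lk|ij]; last first.
    apply/val_inj/eqP; move: lmod; rewrite ij kmod => /eqP.
    by rewrite !modz_small ?ltz_nat ?ltn_ord // eqz_nat eq_sym.
  apply/val_inj/eqP; move: lmod; rewrite lk -kmod => /eqP.
  by rewrite eqz_modDr !modz_small ?ltz_nat ?ltn_ord.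
(* Column [i] of [U] is supported on row [l], so only that term of the sum survives. *)
rewrite mxE (bigD1 l) //= big1 ?addr0 => [|h hl]; last first.
  by rewrite adjE UE lE mxE (negPf hl) mulr0 rmorph0 mul0r.
rewrite adjE !UE lE kE !mxE !eqxx mulr1 !andbT ij.
by case: eqVneq => [->|_]; rewrite ?mulr0 // mulr1 conj_cisM.
Qed.

Theorem proposition4p3 (R : realType) (G : groupType)
  (G_tf : torsion_free G) (G_fg : finitely_generated G)
  (G_nil : nilpotent_group G)
  (m : nat) (a : 'I_m.+1 -> G) (a_basis : malcev_basis a)
  (sigma : G -> G -> int) (sigma_cocycle : cocycle2 sigma)
  (sigma_skinny : skinny (canonical_hom a) sigma)
  (q : mpoly m.+2 rat)
  (sigma_q : forall x y : G,
     (sigma x y)%:~R = qeval q (malcev_coord a x) (canonical_hom a y))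
  (n : nat) (n_gt0 : (0 < n)%N) (n_coprime : coprime_denoms q n)
  (p : R) (p_ge1 : 1 <= p) (x y : G) :
  let D : 'M[R[i]]_n :=
    rho_op R a q n (x * y)%g - rho_op R a q n x *m rho_op R a q n y in
  opnorm D <= 2 * pi * `|sigma x y|%:~R / n%:R /\
  schatten p D <= 2 * pi * `|sigma x y|%:~R * n%:R `^ (p^-1 - 1).
Proof.
move=> D; pose t : R := 2 * pi / n%:R * (sigma x y)%:~R.
have DE : D = (1 - cis t) *: rho_op R a q n (x * y)%g.
  apply: eq_mx_std_basis => j; rewrite mulmxBl -scalemxAl -mulmxA.
  have rhoE := rho_op_std_basis R a_basis sigma_q n_gt0 n_coprime.
  rewrite !rhoE -scalemxAr rhoE.
  (* An element with alpha(z) = j turns every phase q(u, j) into a cocycle value sigma(u, z). The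
     factor 1 fits the shape of [canonical_homE]. *)
  pose z := (expgz (a ord0) j%:Z * 1)%g.
  have <- : canonical_hom a z = j%:Z.
    by apply: canonical_homE => //; case: (malcev_tail_subgroup a 1).
  have qE u v : ratr (qeval q (malcev_coord a u) (canonical_hom a v)) =
      (sigma u v)%:~R :> R.
    by rewrite -sigma_q ratr_int.
  rewrite ![canonical_hom a z + _]addrC [_ + canonical_hom a x]addrC.
  rewrite -!canonical_homM // !qE -mulgA.
  rewrite !scalerA -scalerBl mulrBl mul1r -!cisD -!mulrDr -!rmorphD /=.
  (* What remains is the equality of integer exponents, which is the cocycle identity at (x, y,
     z). *)
  congr ((_ - cis (_ * _%:~R)) *: _).
  have := sigma_cocycle x y z; lia.
(* This is the modulus of [1 - cis t], the scalar in front of the unitary. *)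
pose r := `|2 * sin (t / 2)|.
have r_ge0 : 0 <= r by exact: normr_ge0.
have DD : D^t* *m D = ((r ^+ 2)%:C)%C%:M.
  rewrite DE; set c := 1 - cis t; set U := rho_op _ _ _ _ _.
  have -> : (c *: U)^t* = c^* *: U^t*.
    by apply/matrixP => i j; rewrite !mxE rmorphM.
  rewrite -scalemxAl -scalemxAr scalerA rho_op_unitary //.
  by rewrite scalemx1 conj_1BcisM.
have rt : r <= 2 * pi * `|sigma x y|%:~R / n%:R.
  have -> : 2 * pi * `|sigma x y|%:~R / n%:R = `|t|.
    rewrite /t normrM -intr_norm ger0_norm; last first.
      by rewrite divr_ge0 ?mulr_ge0 ?pi_ge0.
    by rewrite mulrAC.
  rewrite /r normrM ger0_norm //; have := norm_sin_le (t / 2).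
  by rewrite normrM [`|2^-1|]ger0_norm // ler_pdivlMr // mulrC.
split; first exact: le_trans (opnorm_similitude r_ge0 DD) rt.
rewrite (schatten_similitude (lt_le_trans ltr01 p_ge1) r_ge0 DD).
(* Splitting the power of n into n^(-1) and n^(1/p) reduces the claim to the bound [rt]; the split
   needs n nonzero. *)
rewrite (addrC p^-1) powRD ?pnatr_eq0 -?lt0n ?n_gt0 ?implybT //.
by rewrite powR_inv1 // mulrA ler_wpM2r // powR_ge0.
Qed.
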